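(* Let $X,Y,V$ be given spaces, $C\subset X$ closed convex, $h:X\times V\to\mathbb R$ and $g:X\times V\to Y$. Suppose that the nonlinear program $$\min_{x\in C}h(x,v)\quad\text{subject to } g(x,v)=0$$ with $v=0$ has an optimal (primal-dual) solution $(\bar x,\bar y)\in X\times Y$ and that the set-valued mapping $$(x,y)\mapsto\begin{pmatrix}\nabla h(x,0)+\nabla g(x,0)^*y\\ g(x,0)\end{pmatrix}+N_C(x)\times\{0\}$$ is strongly regular at $(\bar x,\bar y)$ for $0$. Then there exists $\bar\varrho>0$ such that for all $\varrho\ge\bar\varrho$ the augmented Lagrangian iteration $$x_{k+1}\in\operatorname*{arg\,min}_{x\in C}\Big\{h(x,v_k)+\langle y_k,g(x,v_k)\rangle+\frac{\varrho}{2}\|g(x,v_k)\|^2\Big\},\qquad y_{k+1}=y_k+\varrho\,g(x_{k+1},v_k)$$ with state $(x_k,y_k)$ and disturbance $v_k\in V$ is locally input-to-state stable around $(\bar x,\bar y)$.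
   Context: Spaces are finite-dimensional or Banach; $Y$ is identified with its dual (as needed for $y_k+\varrho g$ to make sense). Standing assumptions: $h$ and $g$ are continuously differentiable in $x$ at $(\bar x,0)$ uniformly in $v$ and Lipschitz continuous in $v$ uniformly in $x$; $\nabla$ denotes the derivative with respect to $x$, and by convention every gradient that exists is assumed Lipschitz continuous around the point of interest. $N_C(\bar x)=\{u\in X^*:\langle u,x-\bar x\rangle\le0\ \forall x\in C\}$ if $\bar x\in C$, and $\varnothing$ otherwise. A set-valued map $G$ with $(\bar a,\bar b)\in\operatorname{graph}G$ is strongly regular at $\bar a$ for $\bar b$ if there are neighbourhoods $U$ of $\bar a$ and $W$ of $\bar b$ and a Lipschitz continuous function $s$ on $W$ such that $G^{-1}(b)\cap U=\{s(b)\}$ for all $b\in W$. An iteration with state $z_k$ and disturbance $v_k$ is locally input-to-state stable around $\bar z$ if there exist $\epsilon,\delta>0$, $\beta\in\mathcal{KL}$, $\gamma\in\mathcal K_\infty$ such that any sequence $\{z_k\}$ generated under $\|\mathbf v\|_\infty=\sup_k\|v_k\|<\delta$ satisfies $\|z_k-\bar z\|\le\beta(\|z_0-\bar z\|,k)+\gamma(\|\mathbf v\|_\infty)$ for all $k\in\mathbb N$, provided $\|z_0-\bar z\|<\epsilon$.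
   Formalization: The arg min over C is taken over C intersected with an open ball around x̄ of any sufficiently small radius (depending on ϱ), since with global minimisers over C the claim fails, e.g. h=(x₁²−1)², g=x₂, where an iterate may jump from (1,0) to (−1,0). *)

(* Defs.v *)
From HB Require Import structures.
From mathcomp Require Import all_boot all_order all_algebra sesquilinear ring.
From mathcomp Require Import all_classical all_reals all_analysis.

Set Implicit Arguments.
Unset Strict Implicit.
Unset Printing Implicit Defensive.

Import Order.TTheory GRing.Theory Num.Theory.
Import numFieldNormedType.Exports.

Local Open Scope classical_set_scope.
Local Open Scope ring_scope.

(* Continuous linear maps with the operator norm; [clin X R^o] is the dual of
   [X]. *)
Section ContinuousLinear.
Context {R : realType} {X W : normedModType R}.

Definition clin_pred : {pred X -> W} :=
  [pred f : X -> W | `[< linear f /\ continuous f >]].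

Record clin := Clin { clin_fun :> X -> W ; _ : clin_fun \in clin_pred }.

HB.instance Definition _ := [isSub of clin for clin_fun].
HB.instance Definition _ := [Choice of clin by <:].

Lemma clin_predP (f : X -> W) :
  reflect (linear f /\ continuous f) (f \in clin_pred).
Proof. exact: asboolP. Qed.

Lemma clin_submod_closed : submod_closed clin_pred.
Proof.
split=> [|a f g /clin_predP[lf cf] /clin_predP[lg cg]]; apply/clin_predP; split.
- by move=> a u v; rewrite /= scaler0 addr0.
- by move=> x; exact: cst_continuous.
- move=> b u v; rewrite /= !fctE lf lg !scalerDr !scalerA mulrC.
  by rewrite addrACA.
- by move=> x; apply: cvgD; [apply: cvgZl_tmp; exact: cf|exact: cg].
Qed.

HB.instance Definition _ := GRing.isSubmodClosed.Build R (X -> W) clin_pred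
  clin_submod_closed.
HB.instance Definition _ := [SubChoice_isSubLmodule of clin by <:].

Definition opnorm (f : clin) : R := sup [set `|f x| | x in [set x | `|x| <= 1]].

Lemma clin_linear (f : clin) : linear f.
Proof. by case: f => f /= /clin_predP[]. Qed.

Lemma clin_continuous (f : clin) : continuous f.
Proof. by case: f => f /= /clin_predP[]. Qed.

HB.instance Definition _ (f : clin) :=
  GRing.isLinear.Build R X W *:%R f (clin_linear f).

Lemma opnorm_has_ubound (f : clin) :
  has_ubound [set `|f x| | x in [set x | `|x| <= 1]].
Proof.
have /linear_bounded_continuous/bounded_funP/(_ 1)[M fM] := @clin_continuous f.
by exists M => _ [x x1 <-]; exact: fM.
Qed.

Lemma opnorm_ub (f : clin) x : `|x| <= 1 -> `|f x| <= opnorm f.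
Proof. by move=> x1; apply: (ub_le_sup (opnorm_has_ubound f)); exists x. Qed.

Lemma opnorm_lub (f : clin) M :
  (forall x, `|x| <= 1 -> `|f x| <= M) -> opnorm f <= M.
Proof.
move=> fM; apply: ge_sup => [|_ [x x1 <-]]; last exact: fM.
by exists `|f 0|, 0; rewrite //= normr0.
Qed.

Lemma opnorm_bound (f : clin) x : `|f x| <= opnorm f * `|x|.
Proof.
have [->|x0] := eqVneq x 0; first by rewrite linear0 !normr0 mulr0.
have nx : 0 < `|x| by rewrite normr_gt0.
have := @opnorm_ub f (`|x|^-1 *: x).
rewrite linearZ /= !normrZ normfV normr_id mulVf ?gt_eqF// => /(_ (lexx _)).
by rewrite ler_pdivrMl// mulrC.
Qed.

Let opnormD (f g : clin) : opnorm (f + g) <= opnorm f + opnorm g.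
Proof.
apply: opnorm_lub => x x1.
by rewrite (le_trans (ler_normD _ _))// lerD// opnorm_ub.
Qed.

Let opnormZ (a : R) (f : clin) : opnorm (a *: f) = `|a| * opnorm f.
Proof.
have le b h : opnorm (b *: h) <= `|b| * opnorm h.
  apply: opnorm_lub => x x1.
  by rewrite (_ : (b *: h) x = b *: h x)// normrZ ler_wpM2l// opnorm_ub.
have [->|a0] := eqVneq a 0.
  rewrite normr0 mul0r scale0r; apply/le_anti/andP; split.
    by apply: opnorm_lub => x _; rewrite normr0.
  by rewrite (le_trans _ (@opnorm_ub 0 0 _)) ?normr0.
apply/le_anti; rewrite le /= -ler_pdivlMl ?normr_gt0// -normfV.
by rewrite -[X in opnorm X <= _](scalerK a0) le.
Qed.

Let opnorm0_eq0 (f : clin) : opnorm f = 0 -> f = 0.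
Proof.
move=> f0; apply/val_inj/funext => x /=; apply/eqP; rewrite -normr_le0.
by rewrite (le_trans (opnorm_bound f x))// f0 mul0r.
Qed.

HB.instance Definition _ :=
  Lmodule_isNormed.Build R clin opnormD opnormZ opnorm0_eq0.

End ContinuousLinear.
Arguments clin {R} X W.

(* Partial derivative in the first variable. [insubd] only packages ['d f x],
   see [grad1E]; the value is junk where [f] is not differentiable in [x]. *)
Definition grad1 {R : realType} {X V W : normedModType R} (f : X * V -> W)
    (p : X * V) : clin X W :=
  insubd (0 : clin X W) ('d (fun x : X => f (x, p.2)) (p.1) : X -> W).

Lemma grad1E {R : realType} {X V W : normedModType R} (f : X * V -> W) p :
  differentiable (fun x : X => f (x, p.2)) (p.1) ->
  grad1 f p = 'd (fun x : X => f (x, p.2)) (p.1) :> (X -> W).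
Proof.
move=> df; rewrite insubdK//; apply/clin_predP; split; last first.
  exact: diff_continuous.
exact: linearP.
Qed.

(* Continuously differentiable in the first variable at [(x0, 0)] uniformly in
   the second one, and Lipschitz continuous in the second one uniformly in the
   first. The last field is the convention that gradients are Lipschitz
   continuous (in both variables) around the point of interest. *)
Record smooth_at {R : realType} {X V W : normedModType R} (f : X * V -> W)
    (x0 : X) : Prop := {
  smooth_diff : \forall p \near (x0, 0 : V),
    differentiable (fun x : X => f (x, p.2)) (p.1) ;
  smooth_cont : exists2 B : set V, nbhs 0 B & forall e, 0 < e ->
    \forall x \near x0, forall v, B v ->
      `|grad1 f (x, v) - grad1 f (x0, v)| < e ;
  smooth_lip : exists A B L, [/\ nbhs x0 A, nbhs (0 : V) B &
    forall x, A x -> L.-lipschitz_B (fun v : V => f (x, v))] ;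
  smooth_grad_lip : exists2 N : set (X * V), nbhs (x0, 0) N &
    [lipschitz grad1 f p | p in N] }.

Definition normal_cone {R : realType} {X : normedModType R} (C : set X)
    (x : X) : set (clin X R^o) :=
  [set u | C x /\ forall x', C x' -> u (x' - x) <= 0].

Definition strongly_regular {R : realType} {A B : normedModType R}
    (G : A -> set B) (a : A) (b : B) : Prop :=
  G a b /\
  exists (U : set A) (W : set B) (s : B -> A),
    [/\ nbhs a U, nbhs b W, [lipschitz s w | w in W] &
        forall w, W w -> [set z | G z w] `&` U = [set s w]].

Section ComparisonFunctions.
Context {R : realType}.

Definition class_K (alpha : R -> R) : Prop :=
  [/\ {within `[0, +oo[, continuous alpha}, alpha 0 = 0 &
      {in `[0, +oo[ &, {homo alpha : s t / s < t}}].

Definition class_Kinf (alpha : R -> R) : Prop :=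
  class_K alpha /\ alpha s @[s --> +oo] --> +oo.

Definition class_KL (beta : R -> R -> R) : Prop :=
  (forall t, 0 <= t -> class_K (beta ^~ t)) /\
  (forall s, 0 <= s ->
     {in `[0, +oo[ &, {homo beta s : t t' /~ t <= t'}} /\
     beta s t @[t --> +oo] --> 0).

End ComparisonFunctions.

(* Valued in [\bar R] because [sup] of an unbounded set of reals is [0]. *)
Definition supnorm {R : realType} {V : normedModType R} (v : nat -> V) :
    \bar R := ereal_sup (range (fun k => `|v k|%:E)).

(* The dynamics is set-valued: [T z v] is the set of successors of the state
   [z] under the disturbance [v]. *)
Definition locally_ISS {R : realType} {Z V : normedModType R}
    (T : Z -> V -> set Z) (zbar : Z) : Prop :=
  exists eps delta beta gamma,
    [/\ 0 < eps, 0 < delta, class_KL beta, class_Kinf gamma &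
      forall (z : nat -> Z) (v : nat -> V),
        (forall k, T (z k) (v k) (z k.+1)) ->
        (supnorm v < delta%:E)%E -> `|z 0%N - zbar| < eps ->
        forall k, `|z k - zbar| <=
          beta `|z 0%N - zbar| k%:R + gamma (fine (supnorm v))].

Definition argmin {R : realType} {T : Type} (A : set T) (f : T -> R) : set T :=
  [set x | A x /\ forall x', A x' -> f x <= f x'].

Section Program.
Context {R : realType} {X Y V : normedModType R}.
(* [ip] is the scalar product through which [Y] is identified with its dual. *)
Variables (ip : {dot Y for idfun}) (C : set X).
Variables (h : X * V -> R^o) (g : X * V -> Y).

(* [adj A y] is [A^* y], see [adjE]. *)
Definition adj (A : clin X Y) (y : Y) : clin X R^o :=
  insubd (0 : clin X R^o) (fun d => ip (A d) y : R^o).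

Lemma adjE (A : clin X Y) y : (forall y, ip y y = `|y| ^+ 2) ->
  adj A y = (fun d => ip (A d) y) :> (X -> R).
Proof.
move=> ipE; rewrite insubdK//; apply/clin_predP; split.
  by move=> a u w; rewrite linearP linearPl.
have polar d : ip (A d) y = (`|A d + y| ^+ 2 - `|A d - y| ^+ 2) / 4.
  have ipC : ip y (A d) = ip (A d) y.
    by rewrite hermC /= expr0 mul1r.
  rewrite -!ipE !(linearDl, linearDr, linearNl, linearNr) /= ipC; by field.
move=> x; rewrite /continuous_at /= polar; under eq_cvg do rewrite polar.
have cA := @clin_continuous _ _ _ A x.
have norm2 (f : X -> Y) : f @ x --> f x ->
    `|f z| ^+ 2 @[z --> x] --> `|f x| ^+ 2.
  by move=> cf; rewrite expr2; under eq_cvg do rewrite expr2;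
    apply: cvgM; exact: cvg_norm.
apply: (@cvgM R X); last exact: cvg_cst.
apply: (@cvgB R R^o X); apply: norm2.
- by apply: cvgD => //; exact: cvg_cst.
- by apply: cvgB => //; exact: cvg_cst.
Qed.

(* The set-valued map of the optimality conditions of the program with
   disturbance [0]. *)
Definition kkt (z : X * Y) : set (clin X R^o * Y) :=
  [set (grad1 h (z.1, 0) + adj (grad1 g (z.1, 0)) z.2 + u, g (z.1, 0))
  | u in normal_cone C z.1].

Definition optimal_primal_dual (z : X * Y) : Prop :=
  argmin [set x | C x /\ g (x, 0) = 0] (fun x => h (x, 0)) z.1 /\ kkt z 0.

Definition aug_lagrangian (rho : R) (y : Y) (v : V) (x : X) : R :=
  h (x, v) + ip y (g (x, v)) + rho / 2 * `|g (x, v)| ^+ 2.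

(* [D] is the set over which the next iterate is a minimiser. A minimiser over
   the whole of [C] may lie far away from the solution under study, even without
   disturbance (take [h x = (x ^+ 2 - 1) ^+ 2] and [g = 0]), so the local
   statement uses [D = C `&` ball xbar r]. *)
Definition alm_step (D : set X) (rho : R) (z : X * Y) (v : V) : set (X * Y) :=
  [set z' | argmin D (aug_lagrangian rho z.2 v) z'.1 /\
            z'.2 = z.2 + rho *: g (z'.1, v)].

End Program.

(* Main.v *)
Require Import Defs.
From mathcomp Require Import all_boot all_order all_algebra sesquilinear.
From mathcomp Require Import ring lra.
From mathcomp Require Import all_classical all_reals all_analysis.

Import Order.TTheory GRing.Theory Num.Theory.
Import numFieldNormedType.Exports.

Local Open Scope classical_set_scope.
Local Open Scope ring_scope.

(** The iteration is, up to a perturbation of size [`|v|] and a slow drift of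
    the multiplier, the inverse of the optimality map applied to zero.

    Let [(x', y')] be the successor of [(x, y)] under the disturbance [v]. Since
    [x'] minimises over the intersection of the convex set [C] with an open ball,
    it satisfies the first-order condition of the augmented Lagrangian on the
    whole of [C]. The gradient of the augmented Lagrangian at [x'] with
    multiplier [y] is the gradient of the ordinary Lagrangian at [x'] with
    multiplier [y' = y + rho g (x', v)], so [(x', y')] solves the optimality
    system of the undisturbed program up to a right-hand side [(p, q)], where [p]
    collects the differences of gradients between the disturbances [0] and [v],
    and [q = g (x', 0)] differs by at most a multiple of [`|v|] from
    [g (x', v) = (y' - y) / rho] ([argmin_kkt]).

    Strong regularity, with Lipschitz constant [L], gives
    [`|z' - zbar| <= L (c `|v| + (`|z' - zbar| + `|z - zbar|) / rho)]
    ([strongly_regular_calm]). For [rho >= 3 L] the term in [z'] is absorbed and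
    the iteration contracts with factor 1/2 up to a multiple of [`|v|], which
    yields input-to-state stability by a geometric sum
    ([contraction_locally_ISS]).

    Strong regularity applies only if [(x', y')] is close to the solution. The
    localisation provides this: [x'] lies in the ball of radius [r], and [r] may
    depend on [rho], so that [rho g (x', v)], hence the change of the multiplier,
    is small as well. *)

(** * The scalar product *)

Section ScalarProduct.
Context {R : realType} {Y : normedModType R}.
Variable ip : {dot Y for idfun}.
Hypothesis ip_norm : forall y : Y, ip y y = `|y| ^+ 2.

Lemma dot_sym a b : ip a b = ip b a.
Proof. by rewrite hermC /= expr0 mul1r. Qed.

Lemma dot_polarization a b : ip a b = (`|a + b| ^+ 2 - `|a - b| ^+ 2) / 4.
Proof.
rewrite -!ip_norm !(linearDl, linearDr, linearNl, linearNr) /= (dot_sym b a).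
by field.
Qed.

Lemma dot_normD a b : `|a + b| ^+ 2 = `|a| ^+ 2 + 2 * ip a b + `|b| ^+ 2.
Proof.
rewrite -!ip_norm !(linearDl, linearDr) /= (dot_sym b a).
by ring.
Qed.

Lemma dot_le_norm a b : ip a b <= `|a| * `|b|.
Proof.
have := dot_normD a b.
have := ler_normD a b; have := normr_ge0 a; have := normr_ge0 b.
have := normr_ge0 (a + b); set s := `|a + b|; set p := `|a|; set q := `|b|.
move=> s0 q0 p0 spq e; have : s ^+ 2 <= (p + q) ^+ 2.
  by rewrite lerXn2r ?nnegrE ?addr_ge0.
rewrite e; nra.
Qed.

Lemma norm_dot_le a b : `|ip a b| <= `|a| * `|b|.
Proof.
rewrite ler_norml dot_le_norm andbT lerNl.
by have := dot_le_norm (- a) b; rewrite linearNl normrN.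
Qed.

(** Polarization writes the scalar product with norms only, so its joint
    continuity is that of the norm. *)
Lemma cvg_dot {T : Type} {F : set_system T} {FF : Filter F} (f k : T -> Y) a b :
  f @ F --> a -> k @ F --> b -> ip (f t) (k t) @[t --> F] --> (ip a b : R).
Proof.
move=> fa kb; under eq_cvg do rewrite dot_polarization.
rewrite dot_polarization.
have sq (u : T -> Y) c : u @ F --> c -> `|u t| ^+ 2 @[t --> F] --> `|c| ^+ 2.
  by move=> uc; under eq_cvg do rewrite expr2; rewrite expr2;
    apply: cvgM; exact: cvg_norm.
apply: cvgM; last exact: cvg_cst.
by apply: cvgB; apply: sq; [exact: cvgD|exact: cvgB].
Qed.

Lemma adj_subr_norm {X : normedModType R} (A B : clin X Y) y :
  `|adj ip A y - adj ip B y| <= `|A - B| * `|y|.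
Proof.
apply: opnorm_lub => d d1.
rewrite (_ : (_ - _ : clin X R^o) d = adj ip A y d - adj ip B y d)//.
rewrite !adjE// -linearBl.
rewrite (le_trans (norm_dot_le _ _))// ler_wpM2r//.
exact: (@opnorm_ub _ _ _ (A - B)).
Qed.

(** Bounds the residual in the stationarity condition that comes from changing
    the disturbance at a fixed multiplier. *)
Lemma lagrangian_gradient_subr_norm {X : normedModType R} (a b : clin X R^o)
    (A B : clin X Y) y :
  `|a - b + (adj ip A y - adj ip B y)| <= `|a - b| + `|A - B| * `|y|.
Proof.
apply: le_trans (ler_normD _ _) _.
by rewrite lerD2l adj_subr_norm.
Qed.

End ScalarProduct.

(** * First-order conditions for the augmented Lagrangian *)

Lemma diff_cvg_at_right {R : realType} {X W : normedModType R} (f : X -> W) x d :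
  differentiable f x ->
  t^-1 *: (f (t *: d + x) - f x) @[t --> (0:R)^'+] --> 'd f x d.
Proof.
move=> df; rewrite -deriveE//; apply: cvg_dnbhs_at_right.
exact: (diff_derivable (v := d) df).
Qed.

Lemma convex_nearby {R : realType} {X : normedModType R} {C O : set X} {x x'} :
  convex_set C -> open O -> C x -> O x -> C x' ->
  \forall t \near (0 : R)^'+, (C `&` O) (t *: (x' - x) + x).
Proof.
move=> cC oO Cx Ox Cx'; near=> t; split.
  have t0 : 0 <= t by [].
  have t1 : t <= 1 by near: t; apply: nbhs_right_le.
  have /(_ x' x (Itv01 t0 t1)) := cC.
  rewrite !inE => /(_ Cx' Cx).
  suff -> : t *: (x' - x) + x = conv (Itv01 t0 t1) (x' : convex_lmodType X) x by [].
  rewrite /conv/= /unstable.onem scalerBl scalerBr scale1r.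
  by rewrite -addrA (addrC (- _)).
near: t.
have lim_x : t *: (x' - x) + x @[t --> (0 : R)^'+] --> x.
  rewrite -[X in _ --> X]add0r; apply: cvgD; last exact: cvg_cst.
  rewrite -(scale0r (x' - x)); apply: cvgZr_tmp.
  exact: cvg_at_right_filter.
by apply: lim_x; exact: open_nbhs_nbhs.
Unshelve. all: by end_near. Qed.

Section AugmentedLagrangianMinimiser.
Context {R : realType} {X Y V : normedModType R}.
Variable ip : {dot Y for idfun}.
Hypothesis ip_norm : forall y : Y, ip y y = `|y| ^+ 2.
Variables (h : X * V -> R^o) (g : X * V -> Y).

(** The difference quotient of the augmented Lagrangian from [x] in the feasible
    direction [x' - x] is nonnegative for small steps, and its limit is the
    directional derivative. The penalty contributes [rho *: g (x, v)] to the
    multiplier, plus a second-order term that vanishes in the limit. *)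
Lemma aug_lagrangian_argmin_ge0 (C O : set X) rho y v x x' :
  convex_set C -> open O ->
  differentiable (fun x => h (x, v)) x ->
  differentiable (fun x => g (x, v)) x ->
  argmin (C `&` O) (aug_lagrangian ip h g rho y v) x -> C x' ->
  0 <= grad1 h (x, v) (x' - x) +
       adj ip (grad1 g (x, v)) (y + rho *: g (x, v)) (x' - x).
Proof.
move=> cC oO dh dg [[Cx Ox] minx] Cx'; set d := x' - x.
rewrite adjE// !grad1E//.
pose Q t := t^-1 *: (g (t *: d + x, v) - g (x, v)).
have Q_cvg := diff_cvg_at_right (fun x => g (x, v)) x d dg.
have h_cvg := diff_cvg_at_right (fun x => h (x, v)) x d dh.
set A := 'd _ _ d in Q_cvg *; set a := 'd _ _ d in h_cvg *.
have F_cvg : t^-1 *: (h (t *: d + x, v) - h (x, v)) +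
    ip (Q t) (y + rho *: g (x, v)) + rho / 2 * (t * ip (Q t) (Q t))
    @[t --> (0 : R)^'+] --> (a + ip A (y + rho *: g (x, v)) : R).
  have c1 : ip (Q t) (y + rho *: g (x, v)) @[t --> (0 : R)^'+] -->
      (ip A (y + rho *: g (x, v)) : R).
    by apply: (cvg_dot _ ip_norm Q (fun=> _)) => //; exact: cvg_cst.
  have c2 : rho / 2 * (t * ip (Q t) (Q t)) @[t --> (0 : R)^'+] --> (0 : R).
    rewrite [X in _ --> X](_ : 0 = rho / 2 * (0 * ip A A)); last by ring.
    apply: cvgM; first exact: cvg_cst.
    apply: cvgM; last exact: (cvg_dot _ ip_norm).
    by apply: cvg_at_right_filter; exact: cvg_id.
  by rewrite -[X in _ --> X]addr0; apply: cvgD => //; exact: cvgD.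
apply: (cvgr_to_ge F_cvg); near=> t.
have t0 : 0 < t by [].
have /minx : (C `&` O) (t *: d + x) by near: t; exact: convex_nearby.
set w := t *: d + x; rewrite /aug_lagrangian => le.
have gw : g (w, v) = g (x, v) + t *: Q t.
  by rewrite /Q scalerA divff ?gt_eqF// scale1r addrC subrK.
rewrite -(pmulr_rge0 _ t0).
suff -> : t * (t^-1 *: (h (w, v) - h (x, v)) +
    ip (Q t) (y + rho *: g (x, v)) + rho / 2 * (t * ip (Q t) (Q t))) =
  (h (w, v) + ip y (g (w, v)) + rho / 2 * `|g (w, v)| ^+ 2) -
  (h (x, v) + ip y (g (x, v)) + rho / 2 * `|g (x, v)| ^+ 2) by rewrite subr_ge0.
rewrite gw (dot_normD ip)// normrZ exprMn real_normK ?num_real// -!ip_norm.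
move: (Q t) (h (w, v)) (h (x, v)) (g (x, v)) => q hw hx gx.
rewrite (_ : t^-1 *: (hw - hx) = t^-1 * (hw - hx))// !linearDr /=.
rewrite !(linearZr_LR ip) /= !(dot_sym ip q).
move: (ip y q) (ip gx q) (ip gx gx) (ip q q) (ip y gx) => yq gq gg qq yg.
rewrite /GRing.scale /=.
by field; rewrite gt_eqF.
Unshelve. all: by end_near. Qed.

(** The multiplier update is chosen so that the penalty disappears from the
    stationarity condition; what is left is the change of gradients between the
    disturbances [0] and [v]. *)
Lemma argmin_kkt (C O : set X) rho y v x (y' := y + rho *: g (x, v)) :
  convex_set C -> open O ->
  differentiable (fun x => h (x, v)) x ->
  differentiable (fun x => g (x, v)) x ->
  argmin (C `&` O) (aug_lagrangian ip h g rho y v) x ->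
  kkt ip C h g (x, y')
    (grad1 h (x, 0) - grad1 h (x, v) +
     (adj ip (grad1 g (x, 0)) y' - adj ip (grad1 g (x, v)) y'), g (x, 0)).
Proof.
move=> cC oO dh dg minx.
exists (- (grad1 h (x, v) + adj ip (grad1 g (x, v)) y')).
  split=> [|x' Cx']; first by case: minx => -[].
  rewrite (_ : (- _ : clin X R^o) (x' - x) = - (grad1 h (x, v) (x' - x) +
    adj ip (grad1 g (x, v)) y' (x' - x)))// oppr_le0.
  exact: (aug_lagrangian_argmin_ge0 C O).
by congr pair; rewrite opprD addrACA.
Qed.

End AugmentedLagrangianMinimiser.

(** * Constants from the regularity and smoothness assumptions *)

Lemma lipschitz_constant {R : realType} {A B : normedModType R} (f : A -> B)
    (D : set A) : [lipschitz f x | x in D] ->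
  exists2 L, 0 < L & forall x y, D x -> D y -> `|f x - f y| <= L * `|x - y|.
Proof.
case=> M0 [_ M0P]; exists (`|M0| + 1); first by rewrite ltr_wpDl.
have /M0P lip : M0 < `|M0| + 1 by rewrite (le_lt_trans (ler_norm M0))// ltrDl.
by move=> x y Dx Dy; exact: (lip (x, y)).
Qed.

Lemma smooth_at_bounds {R : realType} {X V W : normedModType R}
    {f : X * V -> W} {x0 : X} :
  smooth_at f x0 -> exists e L, [/\ 0 < e, 0 < L &
    forall x v, `|x - x0| < e -> `|v| < e ->
      [/\ differentiable (fun x => f (x, v)) x,
          `|f (x, v) - f (x, 0)| <= L * `|v| &
          `|grad1 f (x, v) - grad1 f (x, 0)| <= L * `|v| ]].
Proof.
case=> dif _ [A [B [L1 [Ax B0 lipf]]]] [N Nx /lipschitz_constant [L2 L20 lipg]].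
have : \forall p \near (x0, 0 : V), differentiable (fun x => f (x, p.2)) p.1 /\ N p.
  by apply: filterI.
case/nbhs_normP => e1 /= e10 e1P.
have [e2 /= e20 e2P] := (nbhs_normP _ _).1 Ax.
have [e3 /= e30 e3P] := (nbhs_normP _ _).1 B0.
exists (Num.min e1 (Num.min e2 e3)), (`|L1| + L2); split.
- by rewrite !lt_min e10 e20.
- by rewrite ltr_wpDl.
move=> x v; rewrite !lt_min => /and3P[x1 x2 _] /and3P[v1 _ v3].
have near_pair w : `|w| < e1 -> ball_ Num.norm (x0, 0 : V) e1 (x, w).
  move=> w1; rewrite /ball_/=.
  rewrite prod_normE /= gt_max distrC x1 /= sub0r normrN//.
have zero1 : `|0 : V| < e1 by rewrite normr0.
have [d Nv] := e1P _ (near_pair _ v1).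
have [_ N0] := e1P _ (near_pair _ zero1).
split => //.
- have Ax' : A x by apply: e2P; rewrite /= distrC.
  have Bv : B v by apply: e3P; rewrite /= sub0r normrN.
  have /= le := lipf x Ax' (v, 0) (conj Bv (nbhs_singleton B0)).
  rewrite subr0 in le; rewrite (le_trans le)//.
  by rewrite ler_wpM2r// (le_trans (ler_norm _))// lerDl ltW.
- rewrite (le_trans (lipg _ _ Nv N0))//.
  rewrite prod_normE /= subrr normr0 subr0 max_r// ler_wpM2r//.
  by rewrite lerDr.
Qed.

(** Near the reference pair the inverse is single-valued and Lipschitz, so the
    distance to the reference solution is controlled by the residual. *)
Lemma strongly_regular_calm {R : realType} {A B : normedModType R}
    (G : A -> set B) (a : A) (b : B) : strongly_regular G a b ->
  exists e L, [/\ 0 < e, 0 < L & forall z w,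
    `|z - a| < e -> `|w - b| < e -> G z w -> `|z - a| <= L * `|w - b|].
Proof.
case=> Gab [U [W [s [aU bW /lipschitz_constant[L L0 s_lip] sE]]]].
have sG z w : W w -> U z -> G z w -> z = s w.
  by move=> Ww Uz Gzw; suff : [set s w] z by []; rewrite -(sE w Ww).
have [eU /= eU0 UP] := (nbhs_normP _ _).1 aU.
have [eW /= eW0 WP] := (nbhs_normP _ _).1 bW.
exists (Num.min eU eW), L; split; rewrite ?lt_min ?eU0// => z w.
rewrite !lt_min => /andP[z_U _] /andP[_ w_W] Gzw.
have Ww : W w by apply: WP; rewrite /= distrC.
have Uz : U z by apply: UP; rewrite /= distrC.
rewrite [z in X in X <= _](sG z w)// (sG a b)//; try exact: nbhs_singleton.
by apply: s_lip => //; exact: nbhs_singleton.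
Qed.

(** * Contractions with additive disturbance are input-to-state stable *)

Section Contraction.
Context {R : realType}.

(** Bernoulli's inequality for [q^-1]. A hyperbola dominates the geometric rate
    and, being rational in the time, is easily seen to be of class KL. *)
Lemma expr_le_hyperbola (q : R) k : 0 < q -> q < 1 ->
  q ^+ k <= (1 + (q^-1 - 1) * k%:R)^-1.
Proof.
move=> q0 q1; have a0 : 0 < q^-1 - 1 by rewrite subr_gt0 invf_gt1.
rewrite -[X in X <= _]invrK lef_pV2 ?posrE ?invr_gt0 ?exprn_gt0//; last first.
  by rewrite ltr_pwDl// mulr_ge0// ltW.
rewrite -exprVn; elim: k => [|k ih]; first by rewrite mulr0 addr0 expr0.
rewrite exprS (le_trans _ (ler_wpM2l _ ih)) ?invr_ge0 ?(ltW q0)//.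
have := mulr_ge0 (mulr_ge0 (ltW a0) (ltW a0)) (ler0n R k).
rewrite -natr1; nra.
Qed.

Definition decay (a s t : R) : R := s / (1 + a * t).

Lemma class_KL_decay a : 0 < a -> class_KL (decay a).
Proof.
move=> a0; have den t : 0 <= t -> 0 < 1 + a * t.
  by move=> t0; rewrite ltr_pwDl// mulr_ge0// ltW.
split=> [t t0|s s0].
  split; first last.
  - move=> u w _ _ uw; rewrite /decay ltr_pM2r// invr_gt0; exact: den.
  - by rewrite /decay mul0r.
  - apply: continuous_subspaceT => u; rewrite /decay.
    by apply: cvgM; [exact: cvg_id|exact: cvg_cst].
split.
  move=> t t'; rewrite !in_itv /= !andbT => t0 t'0 t't; rewrite /decay.
  by rewrite ler_wpM2l// lef_pV2 ?posrE ?den// lerD2l ler_wpM2l// ltW.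
rewrite /decay -(mulr0 s); apply: cvgM; first exact: cvg_cst.
apply/gtr0_cvgV0.
  by near=> t; apply: den.
apply/cvgryPge => A; near=> t.
have At : A / a <= t by near: t; apply: nbhs_pinfty_ge; rewrite num_real.
rewrite ler_pdivrMr// mulrC in At.
by rewrite (le_trans At)// lerDr.
Unshelve. all: by end_near. Qed.

Lemma class_Kinf_linear (c : R) : 0 < c -> class_Kinf (fun s => c * s).
Proof.
move=> c0; split; last by apply: gt0_cvgMry => //; exact: cvg_id.
split.
- by apply: continuous_subspaceT => s; exact: mulrl_continuous.
- by rewrite mulr0.
- by move=> s t _ _; rewrite ltr_pM2l.
Qed.

Lemma supnorm_ub {V : normedModType R} (v : nat -> V) delta :
  (supnorm v < delta%:E)%E -> fine (supnorm v) < delta /\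
  forall k, `|v k| <= fine (supnorm v).
Proof.
move=> lt; have ub k : (`|v k|%:E <= supnorm v)%E.
  by apply: ereal_sup_ubound; exists k.
have fin : supnorm v \is a fin_num.
  rewrite ge0_fin_numE; last by apply: le_trans (ub 0%N); rewrite lee_fin.
  by rewrite (lt_trans lt)// ltry.
by split=> [|k]; rewrite -?lte_fin -?lee_fin fineK.
Qed.

(** The disturbances add up to at most [G = c / (1 - q)] times their supremum.
    The bounds on the initial state and on the disturbance keep the sequence in
    the ball where the contraction estimate holds. *)
Lemma contraction_locally_ISS {Z V : normedModType R} (T : Z -> V -> set Z)
    (zbar : Z) (q c eta : R) :
  0 < q -> q < 1 -> 0 < c -> 0 < eta ->
  (forall z v z', `|z - zbar| < eta -> `|v| < eta -> T z v z' ->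
    `|z' - zbar| <= q * `|z - zbar| + c * `|v|) ->
  locally_ISS T zbar.
Proof.
move=> q0 q1 c0 eta0 step; have q1' : 0 < 1 - q by rewrite subr_gt0.
(* [G] is the fixed point of the recursion for the accumulated disturbance. *)
have [G G0 GE] : exists2 G, 0 < G & G = q * G + c.
  by exists (c / (1 - q)); [rewrite divr_gt0|field; rewrite gt_eqF].
exists (eta / 2), (Num.min eta (eta / (2 * G))), (decay (q^-1 - 1)), (fun s => G * s).
split.
- by rewrite divr_gt0.
- by rewrite lt_min eta0 divr_gt0// mulr_gt0.
- by apply: class_KL_decay; rewrite subr_gt0 invf_gt1.
- exact: class_Kinf_linear.
move=> z v zT /supnorm_ub[+ vs]; set s := fine _ in vs *.
rewrite lt_min => /andP[s_eta s_G] z0 k.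
have s0 : 0 <= s by rewrite (le_trans _ (vs 0%N)).
have Gs : G * s < eta / 2.
  by move: s_G; rewrite ltr_pdivlMr ?mulr_gt0//; lra.
have bound j : `|z j - zbar| <= q ^+ j * `|z 0%N - zbar| + G * s.
  elim: j => [|j ih]; first by rewrite expr0 mul1r lerDl mulr_ge0// ltW.
  have z_eta : `|z j - zbar| < eta.
    have : q ^+ j * `|z 0%N - zbar| <= `|z 0%N - zbar|.
      by rewrite ler_piMl// exprn_ile1// ltW.
    lra.
  rewrite (le_trans (step _ _ _ z_eta (le_lt_trans (vs j) s_eta) (zT j)))//.
  have -> : q ^+ j.+1 * `|z 0%N - zbar| + G * s =
      q * (q ^+ j * `|z 0%N - zbar| + G * s) + c * s.
    by rewrite exprS [in LHS]GE; ring.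
  by rewrite lerD// ler_pM2l.
rewrite (le_trans (bound k))// lerD2r /decay mulrC ler_wpM2l//.
exact: expr_le_hyperbola.
Qed.

End Contraction.

(** * The augmented Lagrangian iteration *)

Theorem proposition4 (R : realType) (X Y V : completeNormedModType R)
    (ip : {dot Y for idfun}) (ip_norm : forall y : Y, ip y y = `|y| ^+ 2)
    (C : set X) (C_closed : closed C) (C_convex : convex_set C)
    (h : X * V -> R^o) (g : X * V -> Y) (xbar : X) (ybar : Y)
    (h_smooth : smooth_at h xbar) (g_smooth : smooth_at g xbar)
    (opt : optimal_primal_dual ip C h g (xbar, ybar))
    (reg : strongly_regular (kkt ip C h g) (xbar, ybar) 0) :
  exists2 rhobar : R, 0 < rhobar & forall rho, rhobar <= rho ->
    \forall r \near 0^'+,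
      locally_ISS (alm_step ip h g (C `&` ball xbar r) rho) (xbar, ybar).
Proof.
have [es [L [es0 L0 reg_bd]]] := strongly_regular_calm _ _ _ reg.
have [eh [Lh [eh0 Lh0 h_bd]]] := smooth_at_bounds h_smooth.
have [eg [Lg [eg0 Lg0 g_bd]]] := smooth_at_bounds g_smooth.
have [e [e0 e_h e_g e_s]] :
    exists e : R, [/\ 0 < e, e <= eh, e <= eg & e <= es].
  exists (Num.min (Num.min eh eg) es).
  by rewrite !lt_min !ge_min eh0 eg0 es0 !lexx !orbT.
(* [3 * L] makes the drift contribute a third of the old and of the new error;
   absorbing the latter leaves the contraction factor 1/2. *)
exists (3 * L); first by rewrite mulr_gt0.
move=> rho rhoL; have rho0 : 0 < rho by rewrite (lt_le_trans _ rhoL)// mulr_gt0.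
have g0 : g (xbar, 0) = 0 by case: opt => -[[_ ->]].
have g_cont : {for xbar, continuous (fun x => g (x, 0 : V))}.
  apply: differentiable_continuous.
  by have [] := g_bd xbar 0; rewrite ?subrr ?normr0.
(* The radius depends on [rho]: it bounds the multiplier step, not only the
   constraint violation. *)
have [rg /= rg0 rgP] : exists2 rg, 0 < rg & forall x, `|x - xbar| < rg ->
    `|g (x, 0)| < e /\ rho * `|g (x, 0)| < e / 4.
  have e'0 : 0 < Num.min e (e / 4 / rho) by rewrite lt_min e0 !divr_gt0.
  have := (cvgrPdist_lt _ _).1 g_cont _ e'0; rewrite g0 => near_g.
  have [rg /= rg0 rgP] := (nbhs_normP _ _).1 (near_g _).
  exists rg => // x xrg; have := rgP x; rewrite /= distrC => /(_ xrg).
  rewrite sub0r normrN lt_min => /andP[-> ?]; split => //.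
  by rewrite mulrC -ltr_pdivlMr.
(* [c] bounds, per unit of disturbance, what the disturbance contributes to both
   components of the residual; [`|ybar| + e] bounds the new multiplier. *)
pose c := Lh + Lg * (`|ybar| + e) + Lg.
have c0 : 0 < c by rewrite /c !addr_gt0// ?mulr_gt0// ltr_wpDl.
pose eta := Num.min (e / 4) (Num.min (e / 4 / (rho * Lg)) (e / c)).
have eta0 : 0 < eta by rewrite !lt_min !divr_gt0// mulr_gt0.
near=> r.
have r_e : r <= e by near: r; exact: nbhs_right_le.
have r_rg : r <= rg by near: r; exact: nbhs_right_le.
apply: (@contraction_locally_ISS _ _ _ _ _ (1 / 2) (3 / 2 * L * c) eta) => //.
- lra.
- by rewrite !mulr_gt0.
move=> [x y] v [x' y']; rewrite /alm_step /= => z_eta.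
rewrite !lt_min => /and3P[v_e v_rho v_c] [minx y'E].
have y_e : `|y - ybar| < e / 4.
  have : `|y - ybar| <= `|(x, y) - (xbar, ybar)|.
    by rewrite prod_normE /= le_max lexx orbT.
  by move=> /le_lt_trans; apply; rewrite (lt_le_trans z_eta)// ge_min lexx.
have x'_r : `|x' - xbar| < r.
  by case: minx => -[_ +] _; rewrite -ball_normE /= distrC.
have v_lt : `|v| < e by rewrite (lt_trans v_e)//; lra.
have x'_e : `|x' - xbar| < e by exact: lt_le_trans r_e.
have [dh _ gh_bd] := h_bd x' v (lt_le_trans x'_e e_h) (lt_le_trans v_lt e_h).
have [dg gv_bd gg_bd] := g_bd x' v (lt_le_trans x'_e e_g) (lt_le_trans v_lt e_g).
have [gx'_e gx'_rho] := rgP x' (lt_le_trans x'_r r_rg).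
have y'y : `|y' - y| = rho * `|g (x', v)|.
  by rewrite y'E addrAC subrr add0r normrZ gtr0_norm.
have v_rho' : rho * (Lg * `|v|) < e / 4.
  by move: v_rho; rewrite ltr_pdivlMr ?mulr_gt0//; lra.
have v_c' : c * `|v| < e by move: v_c; rewrite ltr_pdivlMr// mulrC.
have gv_le : `|g (x', v)| <= `|g (x', 0)| + Lg * `|v|.
  by rewrite -lerBlDl (le_trans (lerB_dist _ _)).
(* A quarter of [e] each for the previous multiplier error, the constraint
   violation at [x'] and the disturbance of the constraint. *)
have y'_e : `|y' - ybar| < e.
  have : `|y' - ybar| <= `|y' - y| + `|y - ybar| by exact: ler_distD.
  have : rho * `|g (x', v)| <= rho * (`|g (x', 0)| + Lg * `|v|) by rewrite ler_pM2l.
  rewrite y'y; lra.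
have z'_s : `|(x', y') - (xbar, ybar)| < es.
  by rewrite prod_normE /= gt_max (lt_le_trans x'_e)//= (lt_le_trans y'_e).
have := argmin_kkt ip ip_norm h g C _ rho y v x' C_convex (ball_open xbar r) dh dg minx.
rewrite -y'E; set p := (X in kkt _ _ _ _ _ (X, _)) => kkt'.
have y'_norm : `|y'| <= `|ybar| + e.
  by rewrite -lerBlDl (le_trans (lerB_dist _ _))// ltW.
have p_le : `|p| <= (Lh + Lg * (`|ybar| + e)) * `|v|.
  apply: le_trans (lagrangian_gradient_subr_norm ip ip_norm _ _ _ _ _) _.
  rewrite mulrDl (distrC (grad1 h _)) (distrC (grad1 g _)).
  apply: lerD => //; rewrite mulrAC; exact: ler_pM.
have w_s : `|(p, g (x', 0)) - 0| < es.
  rewrite subr0 prod_normE /= gt_max.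
  rewrite !(lt_le_trans _ e_s)// (le_lt_trans p_le)// (le_lt_trans _ v_c')//.
  by rewrite ler_wpM2r// /c lerDl ltW.
have z'_le : `|(x', y') - (xbar, ybar)| <= L * (`|p| + `|g (x', 0)|).
  rewrite (le_trans (reg_bd _ _ z'_s w_s kkt'))// ler_pM2l//.
  by rewrite subr0 prod_normE /= ge_max lerDl lerDr !normr_ge0.
have gx'_le : `|g (x', 0)| <= `|g (x', v)| + Lg * `|v|.
  by rewrite -lerBlDl (le_trans (lerB_dist _ _))// distrC.
have y'_z' : `|y' - ybar| <= `|(x', y') - (xbar, ybar)|.
  by rewrite prod_normE /= le_max lexx orbT.
have y_z : `|y - ybar| <= `|(x, y) - (xbar, ybar)|.
  by rewrite prod_normE /= le_max lexx orbT.
have Lg_le : 3 * (L * `|g (x', v)|) <=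
    `|(x', y') - (xbar, ybar)| + `|(x, y) - (xbar, ybar)|.
  have : 3 * L * `|g (x', v)| <= rho * `|g (x', v)| by rewrite ler_wpM2r.
  have := ler_distD ybar y' y; rewrite y'y (distrC ybar); lra.
have pg_le : L * (`|p| + `|g (x', 0)|) <= L * (c * `|v| + `|g (x', v)|).
  rewrite ler_pM2l// /c; lra.
lra.
Unshelve. all: by end_near. Qed.
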